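(* The ennea-algebra (i.e. the ABQR operad with the nine generating operations and 49 relations of an ennea-algebra) is isomorphic to the type product $$(\Omega_T,\Lambda_T)\,\square\,(\Omega_T,\Lambda_T),$$ where $(\Omega_T,\Lambda_T)$ is the type of the dendriform trialgebra of Loday and Ronco.
   Context: $\mathbf{k}$ is a field of characteristic zero. A binary, quadratic, regular operad is identified with its type: a pair $(\Omega,\Lambda)$ with $\Omega$ a finite-dimensional $\mathbf{k}$-vector space of binary operations and $\Lambda\subseteq\Omega^{\otimes 2}\oplus\Omega^{\otimes 2}$ a linear subspace; the element $\big(\sum_i a_i\otimes b_i,\ \sum_j c_j\otimes d_j\big)$ stands for the relation $\sum_i(x\,a_i\,y)\,b_i\,z=\sum_j x\,c_j\,(y\,d_j\,z)$. A structure given by finitely many operation symbols and such relations has type $(\Omega,\Lambda)$ with $\Omega$ having the symbols as basis and $\Lambda$ spanned by the relations. The operad is ABQR with associative operation $\star\in\Omega$ if $(\star\otimes\star,\star\otimes\star)\in\Lambda$. An isomorphism $(\Omega,\Lambda)\to(\Omega',\Lambda')$ of ABQR operads with associative operations $\star,\star'$ is a linear bijection $f:\Omega\to\Omega'$ with $f(\star)=\star'$ and $(f^{\otimes2}\oplus f^{\otimes2})(\Lambda)=\Lambda'$. Square (type) product: write $\left[{\odot_1\atop\odot_2}\right]:=\odot_1\otimes\odot_2\in\Omega_1\otimes\Omega_2$. For $f_i=(a_i\otimes b_i,\ c_i\otimes d_i)$, $i=1,2$, put $\left[{f_1\atop f_2}\right]=\left(\left[{a_1\atop a_2}\right]\otimes\left[{b_1\atop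 b_2}\right],\ \left[{c_1\atop c_2}\right]\otimes\left[{d_1\atop d_2}\right]\right)$, extended bilinearly to $f_i\in\Omega_i^{\otimes2}\oplus\Omega_i^{\otimes2}$ (that is, $((u_1,v_1),(u_2,v_2))\mapsto(\sigma(u_1\otimes u_2),\sigma(v_1\otimes v_2))$, $\sigma$ exchanging the second and third tensor factors). $\Lambda_1\,\square\,\Lambda_2$ is the span of all $\left[{f_1\atop f_2}\right]$ with $f_1\in\Lambda_1,f_2\in\Lambda_2$, and $(\Omega_1,\Lambda_1)\,\square\,(\Omega_2,\Lambda_2)=(\Omega_1\otimes\Omega_2,\Lambda_1\,\square\,\Lambda_2)$, with associative operation $\left[{\star_1\atop\star_2}\right]$. Dendriform trialgebra: $\Omega_T$ has basis $\{\prec,\succ,\circ\}$, $\star=\prec+\succ+\circ$ is the associative operation, and $\Lambda_T$ is spanned by $(\prec\otimes\prec,\prec\otimes\star)$, $(\succ\otimes\prec,\succ\otimes\prec)$, $(\star\otimes\succ,\succ\otimes\succ)$, $(\succ\otimes\circ,\succ\otimes\circ)$, $(\prec\otimes\circ,\circ\otimes\succ)$, $(\circ\otimes\prec,\circ\otimes\prec)$, $(\circ\otimes\circ,\circ\otimes\circ)$. Ennea-algebra: nine generating operations $\nwarrow,\uparrow,\nearrow,\prec,\circ,\succ,\swarrow,\downarrow,\searrow$. Auxiliary operations: $\wedge=\nwarrow+\uparrow+\nearrow$, $\star=\prec+\circ+\succ$, $\vee=\swarrow+\downarrow+\searrow$, $\triangleleft=\nwarrow+\prec+\swarrow$, $\bar\circ=\uparrow+\circ+\downarrow$,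 $\triangleright=\nearrow+\succ+\searrow$; the associative operation is $\bar\star$, the sum of all nine generating operations. The 49 relations are: $(x\nwarrow y)\nwarrow z=x\nwarrow(y\,\bar\star\,z)$, $(x\nearrow y)\nwarrow z=x\nearrow(y\triangleleft z)$, $(x\wedge y)\nearrow z=x\nearrow(y\triangleright z)$, $(x\nearrow y)\uparrow z=x\nearrow(y\,\bar\circ\,z)$, $(x\nwarrow y)\uparrow z=x\uparrow(y\triangleright z)$, $(x\uparrow y)\nwarrow z=x\uparrow(y\triangleleft z)$, $(x\uparrow y)\uparrow z=x\uparrow(y\,\bar\circ\,z)$; $(x\swarrow y)\nwarrow z=x\swarrow(y\wedge z)$, $(x\searrow y)\nwarrow z=x\searrow(y\nwarrow z)$, $(x\vee y)\nearrow z=x\searrow(y\nearrow z)$, $(x\searrow y)\uparrow z=x\searrow(y\uparrow z)$, $(x\swarrow y)\uparrow z=x\downarrow(y\nearrow z)$, $(x\downarrow y)\nwarrow z=x\downarrow(y\nwarrow z)$, $(x\downarrow y)\uparrow z=x\downarrow(y\uparrow z)$; $(x\triangleleft y)\swarrow z=x\swarrow(y\vee z)$, $(x\triangleright y)\swarrow z=x\searrow(y\swarrow z)$, $(x\,\bar\star\,y)\searrow z=x\searrow(y\searrow z)$, $(x\triangleright y)\downarrow z=x\searrow(y\downarrow z)$, $(x\triangleleft y)\downarrow z=x\downarrow(y\searrow z)$, $(x\,\bar\circ\,y)\swarrow z=x\downarrow(y\swarrow z)$, $(x\,\bar\circ\,y)\downarrow z=x\downarrow(y\downarrow z)$; $(x\swarrow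 y)\prec z=x\swarrow(y\star z)$, $(x\searrow y)\prec z=x\searrow(y\prec z)$, $(x\vee y)\succ z=x\searrow(y\succ z)$, $(x\searrow y)\circ z=x\searrow(y\circ z)$, $(x\swarrow y)\circ z=x\downarrow(y\succ z)$, $(x\downarrow y)\prec z=x\downarrow(y\prec z)$, $(x\downarrow y)\circ z=x\downarrow(y\circ z)$; $(x\nwarrow y)\prec z=x\prec(y\vee z)$, $(x\nearrow y)\prec z=x\succ(y\swarrow z)$, $(x\wedge y)\succ z=x\succ(y\searrow z)$, $(x\nearrow y)\circ z=x\succ(y\downarrow z)$, $(x\nwarrow y)\circ z=x\circ(y\searrow z)$, $(x\uparrow y)\prec z=x\circ(y\swarrow z)$, $(x\uparrow y)\circ z=x\circ(y\downarrow z)$; $(x\prec y)\nwarrow z=x\prec(y\wedge z)$, $(x\succ y)\nwarrow z=x\succ(y\nwarrow z)$, $(x\star y)\nearrow z=x\succ(y\nearrow z)$, $(x\succ y)\uparrow z=x\succ(y\uparrow z)$, $(x\prec y)\uparrow z=x\circ(y\nearrow z)$, $(x\circ y)\nwarrow z=x\circ(y\nwarrow z)$, $(x\circ y)\uparrow z=x\circ(y\uparrow z)$; $(x\prec y)\prec z=x\prec(y\star z)$, $(x\succ y)\prec z=x\succ(y\prec z)$, $(x\star y)\succ z=x\succ(y\succ z)$, $(x\succ y)\circ z=x\succ(y\circ z)$, $(x\prec y)\circ z=x\circ(y\succ z)$, $(x\circ y)\prec z=x\circ(y\prec z)$, $(x\circ y)\circ z=x\circ(y\circ z)$. *)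

(* Defs.v *)
From HB Require Import structures.
From mathcomp Require Import all_boot all_order all_algebra.
From mathcomp Require Import ring.
Set Implicit Arguments. Unset Strict Implicit. Unset Printing Implicit Defensive.
Import GRing.Theory.
Local Open Scope ring_scope.

(* The tensor product of two finite-dimensional spaces is modelled by matrices
   of coordinates in the bases [vbasis fullv].  The universal property is
   given by [tens_liftE] and [tens_ext]. *)
Definition tensor (k : fieldType) (U V : vectType k) : Type :=
  'M[k]_(\dim {:U}, \dim {:V}).
HB.instance Definition _ (k : fieldType) (U V : vectType k) :=
  Vector.on (tensor U V).

Definition tens (k : fieldType) (U V : vectType k) (u : U) (v : V) :
    tensor U V :=
  \matrix_(i, j) (coord (vbasis fullv) i u * coord (vbasis fullv) j v).

Notation "u ⊗ v" := (tens u v) (at level 40, left associativity) : ring_scope.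

Definition tens_lift_fun (k : fieldType) (U V W : vectType k)
    (b : U -> V -> W) (t : tensor U V) : W :=
  \sum_i \sum_j t i j *: b (vbasis fullv)`_i (vbasis fullv)`_j.

Definition tens_lift (k : fieldType) (U V W : vectType k) (b : U -> V -> W) :
  'Hom(tensor U V, W) := linfun (tens_lift_fun b).

Section TensorTheory.
Variable k : fieldType.
Implicit Types U V W : vectType k.

Lemma tens_linear_l U V (v : V) : linear (fun u : U => u ⊗ v).
Proof.
by move=> a x y; apply/matrixP=> i j; rewrite !mxE linearP /= mulrDl mulrA.
Qed.

Lemma tens_linear_r U V (u : U) : linear (fun v : V => u ⊗ v).
Proof.
by move=> a x y; apply/matrixP=> i j; rewrite !mxE linearP /= mulrDr mulrCA.
Qed.

Lemma tens_lift_fun_linear U V W (b : U -> V -> W) : linear (tens_lift_fun b).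
Proof.
move=> a x y; rewrite /tens_lift_fun scaler_sumr -big_split /=.
apply: eq_bigr => i _; rewrite scaler_sumr -big_split /=.
by apply: eq_bigr => j _; rewrite !mxE scalerDl scalerA.
Qed.

HB.instance Definition _ U V W (b : U -> V -> W) :=
  GRing.isLinear.Build k (tensor U V) W _ (tens_lift_fun b)
    (tens_lift_fun_linear b).

Lemma linear_sumf U V (f : U -> V) : linear f ->
  forall n (c : 'I_n -> k) (x : 'I_n -> U),
  f (\sum_i c i *: x i) = \sum_i c i *: f (x i).
Proof.
move=> fL n c x.
pose L : {linear U -> V} := HB.pack f (GRing.isLinear.Build k U V _ f fL).
by rewrite -[f]/(GRing.Linear.sort L) linear_sum; apply: eq_bigr => i _; rewrite linearZ.
Qed.

Lemma tens_liftE U V W (b : U -> V -> W) :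
    (forall v, linear (b^~ v)) -> (forall u, linear (b u)) ->
  forall u v, tens_lift b (u ⊗ v) = b u v.
Proof.
move=> bl br u v; rewrite lfunE /= /tens_lift_fun.
rewrite [in RHS](coord_vbasis (memvf u)) (linear_sumf (bl v)).
apply: eq_bigr => i _; rewrite [in RHS](coord_vbasis (memvf v)).
rewrite (linear_sumf (br _)) scaler_sumr.
by apply: eq_bigr => j _; rewrite mxE scalerA.
Qed.

Lemma tens_sum_basis U V (t : tensor U V) :
  t = \sum_i \sum_j t i j *: ((vbasis fullv)`_i ⊗ (vbasis fullv)`_j).
Proof.
have cE W (m l : 'I_(\dim {:W})) :
    coord (vbasis {:W}) m (vbasis {:W})`_l = (m == l)%:R.
  by rewrite coord_free ?(basis_free (vbasisP _)) // eq_sym.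
apply/matrixP=> i j; rewrite summxE (bigD1 i) //= summxE (bigD1 j) //=.
rewrite !mxE !cE !eqxx !mulr1 big1 => [|l nl]; last first.
  by rewrite !mxE !cE [j == l]eq_sym (negPf nl) !mulr0.
rewrite big1 ?addr0 // => l nl; rewrite summxE big1 // => m _.
by rewrite !mxE !cE eq_sym (negPf nl) mul0r mulr0.
Qed.

Lemma tens_ext U V W (f g : 'Hom(tensor U V, W)) :
  (forall u v, f (u ⊗ v) = g (u ⊗ v)) -> f = g.
Proof.
move=> fg; apply/lfunP=> t; rewrite [t]tens_sum_basis !linear_sum.
apply: eq_bigr => i _; rewrite !linear_sum; apply: eq_bigr => j _.
by rewrite !linearZ /= fg.
Qed.

End TensorTheory.

Definition tens_map (k : fieldType) (U U' V V' : vectType k)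
    (f : 'Hom(U, U')) (g : 'Hom(V, V')) : 'Hom(tensor U V, tensor U' V') :=
  tens_lift (fun u v => f u ⊗ g v).

Definition dsum_map (k : fieldType) (U U' V V' : vectType k)
    (f : 'Hom(U, U')) (g : 'Hom(V, V')) : 'Hom((U * V)%type, (U' * V')%type) :=
  linfun (fun p : U * V => (f p.1, g p.2)).

(* The exchange (a ⊗ b) ⊗ (c ⊗ d) |-> (a ⊗ c) ⊗ (b ⊗ d); see [tens_exchE]. *)
Definition tens_exch (k : fieldType) (A B C D : vectType k) :
    'Hom(tensor (tensor A B) (tensor C D), tensor (tensor A C) (tensor B D)) :=
  tens_lift (fun (s : tensor A B) (t : tensor C D) =>
    tens_lift (fun (a : A) (b : B) =>
      tens_lift (fun (c : C) (d : D) => (a ⊗ c) ⊗ (b ⊗ d)) t) s).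

Section MapTheory.
Variable k : fieldType.
Implicit Types U V W : vectType k.

Lemma tens_mapE U U' V V' (f : 'Hom(U, U')) (g : 'Hom(V, V')) u v :
  tens_map f g (u ⊗ v) = f u ⊗ g v.
Proof.
rewrite tens_liftE // => [w a x y|w a x y].
  by rewrite linearP tens_linear_l.
by rewrite linearP tens_linear_r.
Qed.

Lemma dsum_mapE U U' V V' (f : 'Hom(U, U')) (g : 'Hom(V, V')) p :
  dsum_map f g p = (f p.1, g p.2).
Proof.
have lin : linear (fun p : U * V => (f p.1, g p.2)).
  by move=> a x y; rewrite !linearP.
pose M := GRing.isLinear.Build k (U * V)%type (U' * V')%type _ _ lin.
pose L : {linear (U * V)%type -> (U' * V')%type} :=
  HB.pack (fun p : U * V => (f p.1, g p.2)) M.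
by rewrite /dsum_map -/(GRing.Linear.sort L) lfunE.
Qed.

Lemma eq_tens_lift_fun U V W (b b' : U -> V -> W) (t : tensor U V) :
  (forall u v, b u v = b' u v) -> tens_lift_fun b t = tens_lift_fun b' t.
Proof.
by move=> e; apply: eq_bigr => i _; apply: eq_bigr => j _; rewrite e.
Qed.

Lemma tens_lift_fun_comb U V W a (b b' : U -> V -> W) (t : tensor U V) :
  tens_lift_fun (fun u v => a *: b u v + b' u v) t =
  a *: tens_lift_fun b t + tens_lift_fun b' t.
Proof.
rewrite /tens_lift_fun scaler_sumr -big_split; apply: eq_bigr => i _ /=.
rewrite scaler_sumr -big_split; apply: eq_bigr => j _ /=.
by rewrite scalerDr !scalerA mulrC.
Qed.

Lemma tens_exchE (A B C D : vectType k) (a : A) (b : B) (c : C) (d : D) :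
  tens_exch A B C D ((a ⊗ b) ⊗ (c ⊗ d)) = (a ⊗ c) ⊗ (b ⊗ d).
Proof.
rewrite tens_liftE => [|t e x y|s e x y]; last 2 first.
- by rewrite linearP.
- rewrite !lfunE /= -tens_lift_fun_comb; apply: eq_tens_lift_fun => u v.
  by rewrite linearP.
rewrite tens_liftE => [|v e x y|u e x y].
- rewrite tens_liftE // => v e x y.
  + by rewrite tens_linear_r tens_linear_l.
  + by rewrite tens_linear_r tens_linear_r.
- rewrite !lfunE /= -tens_lift_fun_comb; apply: eq_tens_lift_fun => ? ?.
  by rewrite tens_linear_l tens_linear_l.
rewrite !lfunE /= -tens_lift_fun_comb; apply: eq_tens_lift_fun => ? ?.
by rewrite tens_linear_l tens_linear_r.
Qed.

End MapTheory.

Definition relspace (k : fieldType) (V : vectType k) : vectType k :=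
  (tensor V V * tensor V V)%type.

(* [rel a b c d] stands for the relation (x a y) b z = x c (y d z). *)
Definition oprel (k : fieldType) (V : vectType k) (a b c d : V) : relspace V :=
  (a ⊗ b, c ⊗ d).

(* Binary quadratic regular operads, identified with their types. *)
Record optype (k : fieldType) := OpType {
  ops : vectType k;
  oprels : {vspace relspace ops} }.

Record abqr (k : fieldType) := ABQR {
  abqr_type :> optype k;
  assoc_op : ops abqr_type;
  assoc_opP : oprel assoc_op assoc_op assoc_op assoc_op \in oprels abqr_type }.

Definition abqr_isomorphic (k : fieldType) (P Q : abqr k) : Prop :=
  exists f : 'Hom(ops P, ops Q),
    [/\ bijective f,
        f (assoc_op P) = assoc_op Q &
        (dsum_map (tens_map f f) (tens_map f f) @: oprels P)%VS = oprels Q].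

Definition sqrel (k : fieldType) (V W : vectType k)
    (f : relspace V) (g : relspace W) : relspace (tensor V W) :=
  (tens_exch V V W W (f.1 ⊗ g.1), tens_exch V V W W (f.2 ⊗ g.2)).

(* As for [prodv] in the library, the span of all [sqrel f g] is generated by
   the products of basis elements; see [sqrels_subP]. *)
Definition sqrels (k : fieldType) (V W : vectType k)
    (L : {vspace relspace V}) (M : {vspace relspace W}) :
    {vspace relspace (tensor V W)} :=
  (<<[seq sqrel f g | f <- vbasis L, g <- vbasis M]>>)%VS.

Section SquareTheory.
Variable k : fieldType.
Implicit Types V W : vectType k.

Lemma sqrel_linear_l V W (g : relspace W) :
  linear (fun f : relspace V => sqrel f g).
Proof. by move=> a x y; rewrite /sqrel /= !tens_linear_l !linearP. Qed.

Lemma sqrel_linear_r V W (f : relspace V) :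
  linear (fun g : relspace W => sqrel f g).
Proof. by move=> a x y; rewrite /sqrel /= !tens_linear_r !linearP. Qed.

Lemma sqrel_oprel V W (a b c d : V) (a' b' c' d' : W) :
  sqrel (oprel a b c d) (oprel a' b' c' d') =
  oprel (a ⊗ a') (b ⊗ b') (c ⊗ c') (d ⊗ d').
Proof. by rewrite /sqrel /= !tens_exchE. Qed.

Lemma sqrels_subP V W (L : {vspace relspace V}) (M : {vspace relspace W})
    (U : {vspace relspace (tensor V W)}) :
  reflect (forall f g, f \in L -> g \in M -> sqrel f g \in U)
          (sqrels L M <= U)%VS.
Proof.
apply: (iffP idP) => [/subvP sU f g fL gM|sU]; last first.
  apply/span_subvP=> _ /allpairsP[[f g] /= [fL gM ->]].
  by apply: sU; apply: vbasis_mem.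
rewrite (coord_vbasis fL) (linear_sumf (sqrel_linear_l g)).
apply: memv_suml => i _; apply: memvZ.
rewrite (coord_vbasis gM) (linear_sumf (sqrel_linear_r _)).
apply: memv_suml => j _; apply: memvZ; apply: sU.
by apply: memv_span; apply: allpairs_f; apply: mem_nth; rewrite size_tuple.
Qed.

Lemma sqrel_sqrels V W (L : {vspace relspace V}) (M : {vspace relspace W}) f g :
  f \in L -> g \in M -> sqrel f g \in sqrels L M.
Proof. exact: (sqrels_subP _ _ _ (subvv _)). Qed.

End SquareTheory.

Definition sqtype (k : fieldType) (P Q : optype k) : optype k :=
  OpType (sqrels (oprels P) (oprels Q)).

Lemma sq_assoc_opP (k : fieldType) (P Q : abqr k) :
  let s := assoc_op P ⊗ assoc_op Q in oprel s s s s \in oprels (sqtype P Q).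
Proof. by rewrite /= -sqrel_oprel sqrel_sqrels ?assoc_opP. Qed.

Definition sqabqr (k : fieldType) (P Q : abqr k) : abqr k :=
  ABQR (sq_assoc_opP P Q).

(* [n] operation symbols: the standard basis vectors of 'rV_n. *)
Definition symtype (k : fieldType) (n : nat) (r : seq (relspace 'rV[k]_n)) :
  optype k := OpType <<r>>%VS.

Lemma sum_mem_span (k : fieldType) (V : vectType k) (r : seq V) (v : V) :
  v = \sum_(x <- r) x -> v \in <<r>>%VS.
Proof.
move=> ->; rewrite big_seq; apply: memv_suml => x xr; exact: memv_span.
Qed.

Lemma tensE (k : fieldType) (U V : vectType k) (u : U) (v : V) i j :
  (u ⊗ v) i j = coord (vbasis fullv) i u * coord (vbasis fullv) j v.
Proof. exact: mxE. Qed.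

Section DendriformTrialgebra.
Variable k : fieldType.

Local Notation "≺" := (delta_mx 0 0 : 'rV[k]_3).
Local Notation "≻" := (delta_mx 0 1 : 'rV[k]_3).
Local Notation "∘" := (delta_mx 0 2 : 'rV[k]_3).

Definition tri_star : 'rV[k]_3 := ≺ + ≻ + ∘.
Local Notation "⋆" := tri_star.

Definition tri_rels : seq (relspace 'rV[k]_3) :=
  [:: oprel ≺ ≺ ≺ ⋆;
      oprel ≻ ≺ ≻ ≺;
      oprel ⋆ ≻ ≻ ≻;
      oprel ≻ ∘ ≻ ∘;
      oprel ≺ ∘ ∘ ≻;
      oprel ∘ ≺ ∘ ≺;
      oprel ∘ ∘ ∘ ∘].

Lemma tri_assocP : oprel ⋆ ⋆ ⋆ ⋆ \in oprels (symtype tri_rels).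
Proof.
apply: sum_mem_span; rewrite /tri_rels unlock /= /oprel /tri_star.
by congr (_, _); apply/matrixP=> i j; rewrite !(mxE, tensE) !linearD /=; ring.
Qed.

Definition dendriform_trialgebra : abqr k := ABQR tri_assocP.

End DendriformTrialgebra.

Section Ennea.
Variable k : fieldType.

Local Notation "↖" := (delta_mx 0 0 : 'rV[k]_9).
Local Notation "↑" := (delta_mx 0 1 : 'rV[k]_9).
Local Notation "↗" := (delta_mx 0 2 : 'rV[k]_9).
Local Notation "≺" := (delta_mx 0 3 : 'rV[k]_9).
Local Notation "∘" := (delta_mx 0 4 : 'rV[k]_9).
Local Notation "≻" := (delta_mx 0 5 : 'rV[k]_9).
Local Notation "↙" := (delta_mx 0 6 : 'rV[k]_9).
Local Notation "↓" := (delta_mx 0 7 : 'rV[k]_9).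
Local Notation "↘" := (delta_mx 0 8 : 'rV[k]_9).

Definition ennea_wedge : 'rV[k]_9 := ↖ + ↑ + ↗.
Definition ennea_star : 'rV[k]_9 := ≺ + ∘ + ≻.
Definition ennea_vee : 'rV[k]_9 := ↙ + ↓ + ↘.
Definition ennea_ltri : 'rV[k]_9 := ↖ + ≺ + ↙.
Definition ennea_bcirc : 'rV[k]_9 := ↑ + ∘ + ↓.
Definition ennea_rtri : 'rV[k]_9 := ↗ + ≻ + ↘.
Definition ennea_assoc : 'rV[k]_9 := ↖ + ↑ + ↗ + ≺ + ∘ + ≻ + ↙ + ↓ + ↘.

(* ⊚ and ★ are the barred operations ∘ and ⋆. *)
Local Notation "∧" := ennea_wedge.
Local Notation "⋆" := ennea_star.
Local Notation "∨" := ennea_vee.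
Local Notation "◁" := ennea_ltri.
Local Notation "⊚" := ennea_bcirc.
Local Notation "▷" := ennea_rtri.
Local Notation "★" := ennea_assoc.

Definition ennea_rels : seq (relspace 'rV[k]_9) :=
  [:: oprel ↖ ↖ ↖ ★;
      oprel ↗ ↖ ↗ ◁;
      oprel ∧ ↗ ↗ ▷;
      oprel ↗ ↑ ↗ ⊚;
      oprel ↖ ↑ ↑ ▷;
      oprel ↑ ↖ ↑ ◁;
      oprel ↑ ↑ ↑ ⊚;

      oprel ↙ ↖ ↙ ∧;
      oprel ↘ ↖ ↘ ↖;
      oprel ∨ ↗ ↘ ↗;
      oprel ↘ ↑ ↘ ↑;
      oprel ↙ ↑ ↓ ↗;
      oprel ↓ ↖ ↓ ↖;
      oprel ↓ ↑ ↓ ↑;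

      oprel ◁ ↙ ↙ ∨;
      oprel ▷ ↙ ↘ ↙;
      oprel ★ ↘ ↘ ↘;
      oprel ▷ ↓ ↘ ↓;
      oprel ◁ ↓ ↓ ↘;
      oprel ⊚ ↙ ↓ ↙;
      oprel ⊚ ↓ ↓ ↓;

      oprel ↙ ≺ ↙ ⋆;
      oprel ↘ ≺ ↘ ≺;
      oprel ∨ ≻ ↘ ≻;
      oprel ↘ ∘ ↘ ∘;
      oprel ↙ ∘ ↓ ≻;
      oprel ↓ ≺ ↓ ≺;
      oprel ↓ ∘ ↓ ∘;

      oprel ↖ ≺ ≺ ∨;
      oprel ↗ ≺ ≻ ↙;
      oprel ∧ ≻ ≻ ↘;
      oprel ↗ ∘ ≻ ↓;
      oprel ↖ ∘ ∘ ↘;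
      oprel ↑ ≺ ∘ ↙;
      oprel ↑ ∘ ∘ ↓;

      oprel ≺ ↖ ≺ ∧;
      oprel ≻ ↖ ≻ ↖;
      oprel ⋆ ↗ ≻ ↗;
      oprel ≻ ↑ ≻ ↑;
      oprel ≺ ↑ ∘ ↗;
      oprel ∘ ↖ ∘ ↖;
      oprel ∘ ↑ ∘ ↑;

      oprel ≺ ≺ ≺ ⋆;
      oprel ≻ ≺ ≻ ≺;
      oprel ⋆ ≻ ≻ ≻;
      oprel ≻ ∘ ≻ ∘;
      oprel ≺ ∘ ∘ ≻;
      oprel ∘ ≺ ∘ ≺;
      oprel ∘ ∘ ∘ ∘].

Lemma ennea_assocP : oprel ★ ★ ★ ★ \in oprels (symtype ennea_rels).
Proof.
apply: sum_mem_span; rewrite /ennea_rels unlock /= /oprel.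
rewrite /ennea_wedge /ennea_star /ennea_vee /ennea_ltri /ennea_bcirc.
rewrite /ennea_rtri /ennea_assoc.
by congr (_, _); apply/matrixP=> i j; rewrite !(mxE, tensE) !linearD /=; ring.
Qed.

Definition ennea : abqr k := ABQR ennea_assocP.

End Ennea.

(* Main.v *)
From HB Require Import structures.
Require Import Defs.
From mathcomp Require Import all_boot all_order all_algebra.
Import GRing.Theory.
Local Open Scope ring_scope.

(** The nine operations of an ennea-algebra sit in a 3 x 3 grid.  Sending the
  operation in a given row and column to [row ⊗ column], where the rows (from
  top to bottom) and the columns (from left to right) both stand for ≺, ∘, ≻,
  turns the auxiliary operations into the tensors having ⋆ as one factor or as
  both.  The 49 ennea relations then become, in the order in which they are
  listed, the 7 x 7 products of two trialgebra relations. *)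

Lemma tensDl (k : fieldType) (U V : vectType k) (v : V) (u u' : U) :
  (u + u') ⊗ v = u ⊗ v + u' ⊗ v.
Proof. by have := @tens_linear_l k U V v 1 u u'; rewrite !scale1r. Qed.

Lemma tensDr (k : fieldType) (U V : vectType k) (u : U) (v v' : V) :
  u ⊗ (v + v') = u ⊗ v + u ⊗ v'.
Proof. by have := @tens_linear_r k U V u 1 v v'; rewrite !scale1r. Qed.

Lemma dsum_map_oprel (k : fieldType) (V W : vectType k) (f : 'Hom(V, W))
    (a b c d : V) :
  dsum_map (tens_map f f) (tens_map f f) (oprel a b c d) =
  oprel (f a) (f b) (f c) (f d).
Proof. by rewrite dsum_mapE /= !tens_mapE. Qed.

(** By bilinearity of [sqrel], any spanning families can replace the bases chosen by [vbasis] in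
    [sqrels]; the listed relations can thus be multiplied directly. *)
Lemma sqrels_span (k : fieldType) (V W : vectType k)
    (r : seq (relspace V)) (s : seq (relspace W)) :
  sqrels <<r>>%VS <<s>>%VS = <<[seq sqrel f g | f <- r, g <- s]>>%VS.
Proof.
apply/eqP; rewrite eqEsubv; apply/andP; split.
  apply/sqrels_subP => f g fr gs.
  rewrite (coord_span (X := in_tuple r) fr) (linear_sumf (sqrel_linear_l g)).
  apply: memv_suml => i _; apply: memvZ.
  rewrite (coord_span (X := in_tuple s) gs) (linear_sumf (sqrel_linear_r _)).
  apply: memv_suml => j _; apply: memvZ.
  by apply: memv_span; apply: allpairs_f; apply: mem_nth; rewrite ltn_ord.
apply/span_subvP => _ /allpairsP[[f g] /= [fr gs ->]].
by apply: sqrel_sqrels; apply: memv_span.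
Qed.

Definition row_lin_fun {k : fieldType} {n : nat} {V : vectType k}
  (b : 'I_n -> V) (x : 'rV[k]_n) : V := \sum_i x 0 i *: b i.

Definition row_lin {k : fieldType} {n : nat} {V : vectType k}
  (b : 'I_n -> V) : 'Hom('rV[k]_n, V) := linfun (row_lin_fun b).

Lemma row_lin_fun_linear (k : fieldType) (n : nat) (V : vectType k)
    (b : 'I_n -> V) : linear (row_lin_fun b).
Proof.
move=> a x y; rewrite /row_lin_fun scaler_sumr -big_split /=.
by apply: eq_bigr => i _; rewrite !mxE scalerDl scalerA.
Qed.

HB.instance Definition _ (k : fieldType) (n : nat) (V : vectType k)
    (b : 'I_n -> V) :=
  GRing.isLinear.Build k 'rV[k]_n V _ (row_lin_fun b)
    (@row_lin_fun_linear k n V b).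

Lemma row_lin_delta (k : fieldType) (n : nat) (V : vectType k)
    (b : 'I_n -> V) (i : 'I_n) : row_lin b (delta_mx 0 i) = b i.
Proof.
rewrite lfunE /= /row_lin_fun (bigD1 i) //= mxE !eqxx scale1r.
by rewrite big1 ?addr0 // => j ji; rewrite mxE (negPf ji) andbF scale0r.
Qed.

Lemma row_hom_ext (k : fieldType) (n : nat) (V : vectType k)
    (f g : 'Hom('rV[k]_n, V)) :
  (forall i, f (delta_mx 0 i) = g (delta_mx 0 i)) -> f = g.
Proof.
move=> fg; apply/lfunP => x; rewrite (row_sum_delta x) !linear_sum.
by apply: eq_bigr => i _; rewrite !linearZ /= fg.
Qed.

(** Coordinates of tensors refer to [vbasis fullv], which need not be the standard basis, so the
    test on standard basis vectors goes through pure tensors and bilinearity. *)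
Lemma tens_row_hom_ext (k : fieldType) (m n : nat) (V : vectType k)
    (f g : 'Hom(tensor 'rV[k]_m 'rV[k]_n, V)) :
  (forall i j, f (delta_mx 0 i ⊗ delta_mx 0 j) =
               g (delta_mx 0 i ⊗ delta_mx 0 j)) -> f = g.
Proof.
move=> fg; apply: tens_ext => u v; rewrite (row_sum_delta u).
rewrite (linear_sumf (@tens_linear_l k _ _ v)) !linear_sum.
apply: eq_bigr => i _; rewrite !linearZ /=; congr (_ *: _).
rewrite (row_sum_delta v) (linear_sumf (@tens_linear_r k _ _ _)) !linear_sum.
by apply: eq_bigr => j _; rewrite !linearZ /= fg.
Qed.

(* The trialgebra lists its operations as ≺, ≻, ∘ but the grid as ≺, ∘, ≻:
   this involution passes from one order to the other. *)
Definition grid_op (p : nat) : 'I_3 :=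
  match p with 0%N => 0 | 1%N => 2 | _ => 1 end.

(** The grid is numbered row by row from 0; the value is at most 8, so [inZp] changes nothing. *)
Definition grid_index (i j : 'I_3) : 'I_9 := inZp (3 * grid_op i + grid_op j)%N.

Lemma grid_indexK (m : 'I_9) :
  grid_index (grid_op (m %/ 3)%N) (grid_op (m %% 3)%N) = m.
Proof. by apply: val_inj; case: m; do 9! [case=> [//|]]. Qed.

Lemma grid_index_row (i j : 'I_3) : grid_op (grid_index i j %/ 3)%N = i.
Proof.
by apply: val_inj; case: i => [[|[|[|//]]] ?]; case: j => [[|[|[|//]]] ?].
Qed.

Lemma grid_index_col (i j : 'I_3) : grid_op (grid_index i j %% 3)%N = j.
Proof.
by apply: val_inj; case: i => [[|[|[|//]]] ?]; case: j => [[|[|[|//]]] ?].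
Qed.

Section EnneaSquare.
Variable k : fieldType.

Local Notation e i := (delta_mx 0 i : 'rV[k]__).

Definition ennea_to_square : 'Hom('rV[k]_9, tensor 'rV[k]_3 'rV[k]_3) :=
  row_lin (fun m : 'I_9 => e (grid_op (m %/ 3)%N) ⊗ e (grid_op (m %% 3)%N)).

Definition square_to_ennea : 'Hom(tensor 'rV[k]_3 'rV[k]_3, 'rV[k]_9) :=
  tens_lift (fun u v =>
    row_lin (fun i => row_lin (fun j => e (grid_index i j)) v) u).

Lemma square_to_ennea_delta (i j : 'I_3) :
  square_to_ennea (e i ⊗ e j) = e (grid_index i j).
Proof.
rewrite tens_liftE => [|v a x y|u a x y]; last 2 first.
- by rewrite linearP.
(* The second argument enters only through the images prescribed to the outer [row_lin], so
   linearity is checked term by term in its sum. *)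
- rewrite !lfunE /= /row_lin_fun scaler_sumr -big_split /=.
  by apply: eq_bigr => l _; rewrite linearP scalerDr !scalerA mulrC.
by rewrite !row_lin_delta.
Qed.

Lemma ennea_to_square_bij : bijective ennea_to_square.
Proof.
exists square_to_ennea => [x|t].
  (* As an equality of linear maps, the claim need only be checked on basis vectors. *)
  suff /lfunP/(_ x) : (square_to_ennea \o ennea_to_square = \1)%VF.
    by rewrite comp_lfunE id_lfunE.
  apply: row_hom_ext => m; rewrite comp_lfunE id_lfunE row_lin_delta.
  by rewrite square_to_ennea_delta grid_indexK.
suff /lfunP/(_ t) : (ennea_to_square \o square_to_ennea = \1)%VF.
  by rewrite comp_lfunE id_lfunE.
apply: tens_row_hom_ext => i j; rewrite comp_lfunE id_lfunE.
by rewrite square_to_ennea_delta row_lin_delta grid_index_row grid_index_col.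
Qed.

Local Notation "≺" := (delta_mx 0 0 : 'rV[k]_3).
Local Notation "≻" := (delta_mx 0 1 : 'rV[k]_3).
Local Notation "∘" := (delta_mx 0 2 : 'rV[k]_3).
Local Notation "⋆" := (tri_star k).
Local Notation φ := ennea_to_square.

Lemma ennea_to_square_gen :
  (φ (delta_mx 0 0) = ≺ ⊗ ≺) * (φ (delta_mx 0 1) = ≺ ⊗ ∘) *
  (φ (delta_mx 0 2) = ≺ ⊗ ≻) * (φ (delta_mx 0 3) = ∘ ⊗ ≺) *
  (φ (delta_mx 0 4) = ∘ ⊗ ∘) * (φ (delta_mx 0 5) = ∘ ⊗ ≻) *
  (φ (delta_mx 0 6) = ≻ ⊗ ≺) * (φ (delta_mx 0 7) = ≻ ⊗ ∘) *
  (φ (delta_mx 0 8) = ≻ ⊗ ≻).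
Proof. by do ![split]; rewrite row_lin_delta. Qed.

Lemma ennea_to_square_aux :
  (φ (ennea_wedge k) = ≺ ⊗ ⋆) * (φ (ennea_star k) = ∘ ⊗ ⋆) *
  (φ (ennea_vee k) = ≻ ⊗ ⋆) * (φ (ennea_ltri k) = ⋆ ⊗ ≺) *
  (φ (ennea_bcirc k) = ⋆ ⊗ ∘) * (φ (ennea_rtri k) = ⋆ ⊗ ≻) *
  (φ (ennea_assoc k) = ⋆ ⊗ ⋆).
Proof.
(* [tri_star] is summed in the order ≺, ≻, ∘; [addrAC] restores the grid order. *)
have row u : u ⊗ ⋆ = u ⊗ ≺ + u ⊗ ∘ + u ⊗ ≻ by rewrite !tensDr addrAC.
have col v : ⋆ ⊗ v = ≺ ⊗ v + ∘ ⊗ v + ≻ ⊗ v by rewrite !tensDl addrAC.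
do ![split]; rewrite ?col ?row !linearD /= !ennea_to_square_gen //.
(* What remains is [ennea_assoc]: its image is a flat sum of nine terms, while ⋆ ⊗ ⋆ was expanded in
   three groups, one per row. *)
by rewrite !addrA.
Qed.

Lemma map_ennea_rels :
  map (dsum_map (tens_map φ φ) (tens_map φ φ)) (ennea_rels k) =
  [seq sqrel f g | f <- tri_rels k, g <- tri_rels k].
Proof.
rewrite /ennea_rels /tri_rels /= !dsum_map_oprel !sqrel_oprel.
by rewrite !ennea_to_square_aux !ennea_to_square_gen.
Qed.

End EnneaSquare.

Theorem proposition3p5 (k : fieldType) (hk : [pchar k] =i pred0) :
  abqr_isomorphic (ennea k)
    (sqabqr (dendriform_trialgebra k) (dendriform_trialgebra k)).
Proof.
exists (ennea_to_square k); split.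
- exact: ennea_to_square_bij.
- by rewrite /= ennea_to_square_aux.
(* A linear map sends a span to the span of the images, so it suffices that the lists of generators
   agree. *)
- by rewrite limg_span map_ennea_rels -sqrels_span.
Qed.
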